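(* Let $\mathcal{V}$ be a Euclidean Jordan algebra, let $E \subseteq \mathcal{V}$ be a weakly spectral set, and let $a \in E$. Then $a$ operator commutes with every element of the normal cone $N_E(a)$; in particular, $a$ operator commutes with every element of $N_{\langle a\rangle}(a)$.
   Context: $\mathcal{V}$ is a Euclidean Jordan algebra with Jordan product $x\circ y$, inner product $\langle x, y\rangle = \operatorname{tr}(x\circ y)$, where $\operatorname{tr}$ denotes the trace (the sum of the eigenvalues, counted with multiplicity, in the spectral decomposition with respect to a Jordan frame), and unit element $e$. An algebra automorphism is an invertible linear map $A:\mathcal{V}\to\mathcal{V}$ with $A(x\circ y)=A(x)\circ A(y)$ for all $x,y\in\mathcal{V}$; the set of these is $\operatorname{Aut}(\mathcal{V})$. A set $E\subseteq\mathcal{V}$ is weakly spectral if $A(E)\subseteq E$ for all $A\in\operatorname{Aut}(\mathcal{V})$. The automorphism orbit of $a$ is $\langle a\rangle=\{Aa : A\in\operatorname{Aut}(\mathcal{V})\}$. For nonempty $S\subseteq\mathcal{V}$ and $a\in S$, the normal cone is $N_S(a)=\{d\in\mathcal{V} : \langle d, x-a\rangle\le 0 \text{ for all } x\in S\}$. Elements $a,b\in\mathcal{V}$ operator commute if $L_aL_b=L_bL_a$, where $L_c:\mathcal{V}\to\mathcal{V}$, $L_c(x)=c\circ x$; that is, $a\circ(b\circ x)=b\circ(a\circ x)$ for all $x\in\mathcal{V}$. *)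

(* Defs.v *)
From mathcomp Require Import all_boot all_order all_algebra.
From mathcomp Require Import all_classical all_reals.

Set Implicit Arguments.
Unset Strict Implicit.
Unset Printing Implicit Defensive.

Import Order.TTheory GRing.Theory Num.Theory.
Local Open Scope classical_set_scope.
Local Open Scope ring_scope.

(* A (unital) Euclidean Jordan algebra structure on a finite-dimensional real
   vector space: [{dot V for idfun}] is the library's type of symmetric
   positive definite bilinear forms. *)
Record euclidean_jordan_algebra (R : realType) (V : vectType R) := EJA {
  jmul : {bilinear V -> V -> V};
  junit : V;
  jinner : {dot V for idfun};
  jmulC : forall x y : V, jmul x y = jmul y x;
  jmul_jordan : forall x y : V,
    jmul x (jmul (jmul x x) y) = jmul (jmul x x) (jmul x y);
  jmul1e : forall x : V, jmul junit x = x;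
  jinner_assoc : forall x y z : V, jinner (jmul x y) z = jinner y (jmul x z)
}.

Section EuclideanJordanAlgebra.
Variables (R : realType) (V : vectType R) (J : euclidean_jordan_algebra V).

Definition idempotent_elt (c : V) : Prop := jmul J c c = c.

Definition primitive_idempotent (c : V) : Prop :=
  [/\ idempotent_elt c, c != 0 &
      ~ exists c1 c2 : V,
          [/\ idempotent_elt c1, idempotent_elt c2, c1 != 0, c2 != 0 &
              c = c1 + c2]].

Definition jordan_frame (r : nat) (c : 'I_r -> V) : Prop :=
  [/\ forall i, primitive_idempotent (c i),
      forall i j, i != j -> jmul J (c i) (c j) = 0 &
      \sum_(i < r) c i = junit J].

(* The [l i] are the eigenvalues of [x], repeated according to multiplicity. *)
Definition spectral_decomposition (x : V) (r : nat) (c : 'I_r -> V)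
    (l : 'I_r -> R) : Prop :=
  jordan_frame c /\ x = \sum_(i < r) l i *: c i.

(* By the spectral theorem, every [x] has a spectral decomposition and the sum
   of the eigenvalues does not depend on it: the set below is a singleton and
   the default value 0 of [xget] is never used. *)
Definition jtrace (x : V) : R :=
  xget 0 [set t | exists r (c : 'I_r -> V) (l : 'I_r -> R),
                    spectral_decomposition x c l /\ t = \sum_(i < r) l i].

Definition trace_inner_product : Prop :=
  forall x y : V, jinner J x y = jtrace (jmul J x y).

Definition jautomorphism (A : 'End(V)) : Prop :=
  bijective A /\ forall x y : V, A (jmul J x y) = jmul J (A x) (A y).

Definition weakly_spectral (E : set V) : Prop :=
  forall A : 'End(V), jautomorphism A -> A @` E `<=` E.

Definition jorbit (a : V) : set V :=
  [set x | exists2 A : 'End(V), jautomorphism A & x = A a].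

Definition normal_cone (S : set V) (a : V) : set V :=
  [set d | forall x, S x -> jinner J d (x - a) <= 0].

Definition jL (c : V) : V -> V := fun x => jmul J c x.

Definition operator_commute (a b : V) : Prop :=
  jL a \o jL b =1 jL b \o jL a.

End EuclideanJordanAlgebra.

(* Main.v *)
(** Let [D = [L_x, L_z]]. The Jordan identity makes [D] a derivation, and
    associativity of the inner product makes it skew, so [exp (t D)] is an
    automorphism for every real [t]. If [d] is normal to the orbit of [a] at
    [a], then [<d, exp (t D) a - a> <= 0] for all [t]; since the left-hand side
    is [t <d, D a> + O(t^2)], letting [t] tend to 0 from both sides gives
    [<d, D a> = 0]. By associativity of the inner product this says
    [<[L_a, L_d] z, x> = 0] for all [x] and [z]. The general case follows, as
    the normal cone of a weakly spectral set at [a] is contained in that of the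
    orbit of [a]. *)
From HB Require Import structures.
Require Import Defs.
From mathcomp Require Import all_boot all_order all_algebra.
From mathcomp Require Import all_classical all_reals all_analysis.
From mathcomp Require Import ring lra.

Set Implicit Arguments.
Unset Strict Implicit.
Unset Printing Implicit Defensive.
Import Order.TTheory GRing.Theory Num.Theory numFieldNormedType.Exports.
Local Open Scope classical_set_scope.
Local Open Scope ring_scope.

(** * Leibniz rule and rearrangement of double sums *)

(** Induction by Pascal's rule. Stating it for an abstract array [u] covers both a derivation acting
    on products and the zero map acting on inner products. *)
Lemma iter_leibniz (W : zmodType) (T : {additive W -> W}) (u : nat -> nat -> W)
    (m : nat) :
  (forall i j, T (u i j) = u i.+1 j + u i j.+1) ->
  iter m T (u 0 0)%N = \sum_(k < m.+1) u k (m - k)%N *+ 'C(m, k).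
Proof.
move=> Tu; elim: m => [|m IH]; first by rewrite big_ord1.
rewrite iterS IH raddf_sum /=.
under eq_bigr do rewrite raddfMn /= Tu mulrnDl.
rewrite big_split /= [RHS]big_ord_recl /= bin0 subn0 mulr1n.
under [in RHS]eq_bigr do rewrite /bump leq0n add1n subSS binS mulrnDr.
rewrite [in RHS]big_split /= addrA addrC; congr (_ + _).
rewrite [in LHS]big_ord_recl [in RHS]big_ord_recr /= subn0 bin0 mulr1n.
rewrite bin_small ?ltnSn // mulr0n addr0; congr (_ + _).
by apply: eq_bigr => i _; rewrite /bump leq0n add1n subnSK.
Qed.

(** Exchange the sums over [k <= m < n], then substitute [j = m - k]. *)
Lemma triangle_sum (W : nmodType) (F : nat -> nat -> W) (n : nat) :
  \sum_(m < n) \sum_(k < m.+1) F k (m - k)%N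
  = \sum_(k < n) \sum_(0 <= j < n - k) F k j.
Proof.
under eq_bigr => m _.
  rewrite (big_ord_widen n (fun k => F k (m - k)%N)) //.
  over.
rewrite (exchange_big_dep predT) //=; apply: eq_bigr => k _.
rewrite -(big_mkord (fun m => k < m.+1)%N (fun m => F k (m - k)%N)).
rewrite [LHS](big_cat_nat (n := k)) //= ?(ltnW (ltn_ord k)) //.
rewrite big1_seq ?add0r; last first.
  move=> i; rewrite mem_index_iota ltnS.
  by move=> /andP[/leq_ltn_trans H /andP[_ /H]]; rewrite ltnn.
have := big_addn (op := +%R) (idx := 0) 0 n k (fun m => k < m.+1)%N
  (fun m => F k (m - k)%N).
rewrite add0n => ->; rewrite big_nat_cond [RHS]big_nat_cond.
by apply: eq_big => [i|i _]; rewrite ?andbT ?ltnS ?leq_addl ?andbT ?addnK.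
Qed.

Lemma square_sub_triangle (W : zmodType) (F : nat -> nat -> W) (n : nat) :
  \sum_(k < n) \sum_(j < n) F k j - \sum_(m < n) \sum_(k < m.+1) F k (m - k)%N
  = \sum_(k < n) \sum_(n - k <= j < n) F k j.
Proof.
rewrite triangle_sum -sumrB; apply: eq_bigr => k _.
rewrite -(big_mkord predT (F k)) (big_cat_nat (n := (n - k)%N)) ?leq_subr //=.
by rewrite addrAC subrr add0r.
Qed.

(** * Domination by the exponential series *)

Section DominatedSeries.
Variable R : realType.

Lemma cvg_series_expR (x : R) : series (exp_coeff x) @ \oo --> expR x.
Proof. exact: is_cvg_series_exp_coeff. Qed.

(** By the binomial theorem, the triangular sum of the products is the partial sum of the series for
    [expR (M + M)]. *)
Lemma exp_square_sub_triangle (M : R) (n : nat) :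
  \sum_(k < n) \sum_(n - k <= j < n) exp_coeff M k * exp_coeff M j
  = series (exp_coeff M) n ^+ 2 - series (exp_coeff (M + M)) n.
Proof.
rewrite -(square_sub_triangle (fun k j => exp_coeff M k * exp_coeff M j)).
congr (_ - _).
  rewrite /series /= big_mkord expr2 mulr_suml; apply: eq_bigr => i _.
  by rewrite mulr_sumr.
rewrite /series /= big_mkord; apply: eq_bigr => m _.
rewrite /exp_coeff /= exprDn mulr_suml; apply: eq_bigr => i _.
have fact_neq0 k : (k`!)%:R != 0 :> R by rewrite pnatr_eq0 -lt0n fact_gt0.
have /(congr1 (fun k => k%:R : R)) := bin_fact (ltnSE (ltn_ord i)).
rewrite !natrM => <-; rewrite -mulr_natr.
have : 'C(m, i)%:R != 0 :> R by rewrite pnatr_eq0 -lt0n bin_gt0 ltnSE.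
by move: (fact_neq0 i) (fact_neq0 (m - i)%N) => *; field; apply/and3P.
Qed.

Lemma cvg_exp_square_sub_triangle (M : R) :
  (\sum_(k < n) \sum_(n - k <= j < n) exp_coeff M k * exp_coeff M j)
    @[n --> \oo] --> 0.
Proof.
under eq_cvg do rewrite exp_square_sub_triangle expr2.
have eM := @cvg_series_expR M.
by have := cvgB (cvgM eM eM) (@cvg_series_expR (M + M)); rewrite expRD subrr; exact.
Qed.

(** The difference is the sum over [k, j < n] with [k + j >= n]. It is dominated by the same sum for
    the exponential, which tends to [expR M ^+ 2 - expR (M + M) = 0]. *)
Lemma cvg_square_sub_triangle (F : nat -> nat -> R) (C M : R) :
  (forall i j, `|F i j| <= C * (exp_coeff M i * exp_coeff M j)) ->
  (\sum_(k < n) \sum_(j < n) F k j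
   - \sum_(m < n) \sum_(k < m.+1) F k (m - k)%N) @[n --> \oo] --> 0.
Proof.
move=> FC; under eq_cvg do rewrite square_sub_triangle.
apply: norm_cvg0.
have H : (C * \sum_(k < n) \sum_(n - k <= j < n) exp_coeff M k * exp_coeff M j)
    @[n --> \oo] --> 0.
  have := cvgMr (a := C) (@cvg_exp_square_sub_triangle M).
  by rewrite mulr0; exact.
apply: (squeeze_cvgr _ (cvg_cst 0) H); near=> n.
rewrite normr_ge0 /= mulr_sumr; apply: le_trans (ler_norm_sum _ _ _) _.
apply: ler_sum => k _; rewrite mulr_sumr.
by apply: le_trans (ler_norm_sum _ _ _) _; apply: ler_sum.
Unshelve. all: by end_near. Qed.

Lemma cvg_series_dominated_exp (u : nat -> R) (C M : R) :
  (forall k, `|u k| <= C * exp_coeff M k) -> cvgn (series u).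
Proof.
move=> uC; apply: normed_cvg.
apply: (@series_le_cvg _ _ (fun k => C * exp_coeff M k)).
- by move=> k; exact: normr_ge0.
- by move=> k; apply: le_trans (uC k).
- exact: uC.
- apply: is_cvg_seriesZ; exact: is_cvg_series_exp_coeff.
Qed.

(** The tail from index 2 is at most [C] times that of the exponential series, namely
    [expR M - 1 - M]. *)
Lemma dominated_series_taylor1 (u : nat -> R) (l C M : R) : 0 <= M -> M <= 2^-1 ->
  (forall k, `|u k| <= C * exp_coeff M k) -> series u @ \oo --> l ->
  `|l - u 0%N - u 1%N| <= C * (2 * M ^+ 2).
Proof.
move=> M0 M2 uC ul.
have C0 : 0 <= C.
  have := le_trans (normr_ge0 _) (uC 0%N).
  by rewrite /exp_coeff /= fact0 expr0 divr1 mulr1.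
have H : expR M - 1 - M <= 2 * M ^+ 2.
  (* [1 - M <= expR (- M)] gives [expR M <= 1 / (1 - M)]. *)
  have := expR_ge1Dx (- M); rewrite expRN => h.
  have e0 := expR_gt0 M.
  have : (1 - M) * expR M <= 1.
    by rewrite -[leRHS](mulVf (lt0r_neq0 e0)) ler_pM2r.
  nra.
apply: le_trans (ler_wpM2l C0 H).
have L : `|series u n - u 0%N - u 1%N| @[n --> \oo] --> `|l - u 0%N - u 1%N|.
  by apply: cvg_norm; apply: cvgB (cvg_cst _); apply: cvgB (cvg_cst _).
have L' : C * (series (exp_coeff M) n - 1 - M) @[n --> \oo] -->
    C * (expR M - 1 - M).
  apply: cvgMr; apply: cvgB (cvg_cst _); apply: cvgB (cvg_cst _).
  exact: is_cvg_series_exp_coeff.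
apply: (ler_cvg_to L L'); near=> n.
(* From [n = 2] on, the subtracted terms cancel the first two of each partial sum, and the tails are
   compared termwise. *)
have n2 : (1 < n)%N by near: n; exact: nbhs_infty_gt.
rewrite /series /= -(subnK n2) addn2 !big_nat_recl //=.
rewrite [u 0%N + _]addrC addrK [u 1%N + _]addrC addrK.
have -> : exp_coeff M 0%N = 1 by rewrite /exp_coeff /= fact0 expr0 divr1.
have -> : exp_coeff M 1%N = M by rewrite /exp_coeff /= expr1 divr1.
rewrite [1 + _]addrC addrK [M + _]addrC addrK mulr_sumr.
by apply: le_trans (ler_norm_sum _ _ _) _; apply: ler_sum.
Unshelve. all: by end_near. Qed.

End DominatedSeries.

(** * Exponential of an endomorphism *)

Section Exponential.
Variables (R : realType) (V : vectType R).

Local Notation e_ i := ((vbasis (@fullv _ V))`_i).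
Local Notation co_ i := (coord (vbasis (@fullv _ V)) i).

(** Linear forms are plain functions with a hypothesis [scalar f], so that partial applications of a
    bilinear [B] qualify directly; a bundled form is packed only inside proofs. *)
Lemma scalar_coordE (f : V -> R) (v : V) :
  scalar f -> f v = \sum_i co_ i v * f (e_ i).
Proof.
move=> lf; pose F : {scalar V} := HB.pack f (GRing.isLinear.Build _ _ _ _ f lf).
rewrite -[f]/(F : V -> R) {1}(coord_vbasis (memvf v)) linear_sum.
by apply: eq_bigr => i _; rewrite linearZ.
Qed.

Lemma scalar_coord i : scalar (co_ i).
Proof. by move=> a u v; rewrite linearP. Qed.

Lemma scalar_ext (x y : V) : (forall f : V -> R, scalar f -> f x = f y) -> x = y.
Proof.
move=> xy; rewrite (coord_vbasis (memvf x)) (coord_vbasis (memvf y)).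
by apply: eq_bigr => i _; rewrite (xy (co_ i)) //; exact: scalar_coord.
Qed.

(** The l1 norm in the chosen basis, used only for growth estimates. *)
Definition coord_norm (v : V) : R := \sum_i `|co_ i v|.

Lemma coord_norm_ge0 v : 0 <= coord_norm v.
Proof. exact: sumr_ge0. Qed.

Lemma scalar_bounded (f : V -> R) : scalar f ->
  exists2 C, 0 <= C & forall v, `|f v| <= C * coord_norm v.
Proof.
move=> lf; exists (\sum_(i < \dim (@fullv _ V)) `|f (e_ i)|) => [|v].
  exact: sumr_ge0.
rewrite (scalar_coordE v lf) /coord_norm mulr_sumr.
apply: le_trans (ler_norm_sum _ _ _) _; apply: ler_sum => i _.
rewrite normrM mulrC ler_wpM2r // (bigD1 i) //= lerDl; exact: sumr_ge0.
Qed.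

Lemma biscalar_bounded (B : V -> V -> R) :
  (forall x, scalar (B x)) -> (forall y, scalar (B^~ y)) ->
  exists2 C, 0 <= C &
    forall x y, `|B x y| <= C * (coord_norm x * coord_norm y).
Proof.
move=> lr ll.
have /choice[c c_ub] : forall i : 'I_(\dim (@fullv _ V)), exists C : R,
    0 <= C /\ forall v, `|B (e_ i) v| <= C * coord_norm v.
  by move=> i; have [C C0 H] := scalar_bounded (lr (e_ i)); exists C.
exists (\sum_i c i) => [|x y]; first by apply: sumr_ge0 => i _; case: (c_ub i).
rewrite (scalar_coordE x (ll y)) mulrCA mulr_suml.
apply: le_trans (ler_norm_sum _ _ _) _; apply: ler_sum => i _.
rewrite normrM ler_wpM2l //; case: (c_ub i) => ci0 /(_ y)/le_trans; apply.
rewrite ler_wpM2r ?coord_norm_ge0 // (bigD1 i) //= lerDl.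
by apply: sumr_ge0 => j _; case: (c_ub j).
Qed.

Lemma endo_bounded (D : 'End(V)) :
  exists2 M, 0 <= M & forall v, coord_norm (D v) <= M * coord_norm v.
Proof.
have /choice[c c_ub] : forall i, exists C : R,
    0 <= C /\ forall v, `|co_ i (D v)| <= C * coord_norm v.
  move=> i; have [|C C0 H] := @scalar_bounded (fun v => co_ i (D v)).
    by move=> a u v; rewrite !linearP.
  by exists C.
exists (\sum_i c i) => [|v]; first by apply: sumr_ge0 => i _; case: (c_ub i).
by rewrite mulr_suml; apply: ler_sum => i _; case: (c_ub i) => _; apply.
Qed.

Lemma coord_norm_iter (D : 'End(V)) (M : R) : 0 <= M ->
  (forall v, coord_norm (D v) <= M * coord_norm v) ->
  forall k v, coord_norm (iter k D v) <= M ^+ k * coord_norm v.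
Proof.
move=> M0 DM; elim=> [|k IH] v; first by rewrite expr0 mul1r.
by rewrite iterS (le_trans (DM _)) // exprS -mulrA ler_wpM2l.
Qed.

Lemma scalar_iter_bounded (D : 'End(V)) (f : V -> R) (x : V) : scalar f ->
  exists C M, 0 <= M /\ forall k, `|f (iter k D x)| <= C * M ^+ k.
Proof.
move=> /scalar_bounded[C C0 fC]; have [M M0 DM] := endo_bounded D.
exists (C * coord_norm x), M; split=> // k.
by rewrite (le_trans (fC _)) // -mulrA ler_wpM2l // mulrC coord_norm_iter.
Qed.

Definition exp_sum (D : 'End(V)) (n : nat) (x : V) : V :=
  \sum_(k < n) (k`!%:R)^-1 *: iter k D x.

Lemma scalar_exp_sum (D : 'End(V)) (f : V -> R) (x : V) : scalar f ->
  (fun n => f (exp_sum D n x)) = series (fun k => f (iter k D x) / k`!%:R).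
Proof.
move=> lf; pose F : {scalar V} := HB.pack f (GRing.isLinear.Build _ _ _ _ f lf).
apply/funext => n; rewrite /series /= big_mkord -[f]/(F : V -> R) linear_sum.
by apply: eq_bigr => k _; rewrite linearZ /= mulrC.
Qed.

Lemma is_cvg_scalar_exp_sum (D : 'End(V)) (f : V -> R) (x : V) : scalar f ->
  cvgn (fun n => f (exp_sum D n x)).
Proof.
move=> lf; have [C [M [M0 fC]]] := scalar_iter_bounded D x lf.
rewrite scalar_exp_sum //; apply: (@cvg_series_dominated_exp _ _ C M) => k.
by rewrite normrM normfV normr_nat /exp_coeff mulrA ler_wpM2r ?invr_ge0.
Qed.

(* [V] carries no topology, so limits in [V] are taken coordinatewise and
   convergence is expressed by testing against all linear forms. *)
Definition exp_endo (D : 'End(V)) (x : V) : V :=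
  \sum_i limn (fun n => co_ i (exp_sum D n x)) *: e_ i.

Lemma cvg_sumr (I : finType) (F : I -> nat -> R) (l : I -> R) :
  (forall i, F i @ \oo --> l i) -> (\sum_i F i n) @[n --> \oo] --> \sum_i l i.
Proof. by move=> Fl; apply: cvg_big => //; exact: add_continuous. Qed.

Lemma cvg_scalar_exp_sum (D : 'End(V)) (f : V -> R) (x : V) : scalar f ->
  f (exp_sum D n x) @[n --> \oo] --> f (exp_endo D x).
Proof.
move=> lf; pose F : {scalar V} := HB.pack f (GRing.isLinear.Build _ _ _ _ f lf).
under eq_cvg do rewrite (scalar_coordE _ lf).
rewrite /exp_endo -[f]/(F : V -> R) linear_sum.
apply: cvg_sumr => i; rewrite linearZ /=.
by apply: cvgMl; exact: is_cvg_scalar_exp_sum (@scalar_coord i).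
Qed.

Lemma exp_sum_linear (D : 'End(V)) n : linear (exp_sum D n).
Proof.
move=> a u v; rewrite /exp_sum scaler_sumr -big_split /=.
apply: eq_bigr => k _; rewrite scalerA mulrC -scalerA -scalerDr; congr (_ *: _).
by elim: (nat_of_ord k) => //= k' ->; rewrite linearP.
Qed.

Lemma exp_endo_linear (D : 'End(V)) : linear (exp_endo D).
Proof.
move=> a u v; apply: scalar_ext => f lf; rewrite lf.
rewrite -(cvg_lim (@Rhausdorff R) (@cvg_scalar_exp_sum D f (a *: u + v) lf)).
apply: cvg_lim => //; under eq_cvg do rewrite exp_sum_linear lf.
by apply: cvgD; [apply: cvgMr|]; exact: cvg_scalar_exp_sum.
Qed.

HB.instance Definition _ (D : 'End(V)) :=
  GRing.isLinear.Build R V V _ (exp_endo D) (exp_endo_linear D).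

Lemma cvg_biscalar_exp_sum (D : 'End(V)) (B : V -> V -> R) (x y : V) :
  (forall x, scalar (B x)) -> (forall y, scalar (B^~ y)) ->
  B (exp_sum D n x) (exp_sum D n y) @[n --> \oo] -->
    B (exp_endo D x) (exp_endo D y).
Proof.
move=> lr ll; rewrite (scalar_coordE _ (ll _)).
under eq_cvg do rewrite (scalar_coordE _ (ll _)).
apply: cvg_sumr => i; apply: cvgM.
  exact: cvg_scalar_exp_sum (@scalar_coord i).
exact: cvg_scalar_exp_sum.
Qed.

(** Cauchy product of two exponential series under [B]: the square partial sums converge to the
    limit, and the triangular ones differ from them by a null sequence. *)
Lemma cvg_biscalar_cauchy (D : 'End(V)) (B : V -> V -> R) (x y : V) :
  (forall x, scalar (B x)) -> (forall y, scalar (B^~ y)) ->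
  series (fun m =>
      (\sum_(k < m.+1) B (iter k D x) (iter (m - k) D y) *+ 'C(m, k)) / m`!%:R)
    @ \oo --> B (exp_endo D x) (exp_endo D y).
Proof.
move=> lr ll; have [M M0 DM] := endo_bounded D.
have [C C0 BC] := biscalar_bounded lr ll.
pose F k j := B (iter k D x) (iter j D y) / k`!%:R / j`!%:R.
have FC k j : `|F k j| <=
    C * (coord_norm x * coord_norm y) * (exp_coeff M k * exp_coeff M j).
  rewrite /F !normrM !normfV !normr_nat /exp_coeff /=.
  rewrite [leRHS](_ : _ = C * ((M ^+ k * coord_norm x) *
    (M ^+ j * coord_norm y)) / k`!%:R / j`!%:R); last by ring.
  rewrite !ler_wpM2r ?invr_ge0 //; apply: le_trans (BC _ _) _.
  by rewrite ler_wpM2l // ler_pM ?coord_norm_ge0 // coord_norm_iter.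
have fact_neq0 i : (i`!)%:R != 0 :> R by rewrite pnatr_eq0 -lt0n fact_gt0.
have BE n : B (exp_sum D n x) (exp_sum D n y) = \sum_(k < n) \sum_(j < n) F k j.
  pose BL y : {scalar V} :=
    HB.pack (B^~ y) (GRing.isLinear.Build _ _ _ _ _ (ll y)).
  pose BR x : {scalar V} :=
    HB.pack (B x) (GRing.isLinear.Build _ _ _ _ _ (lr x)).
  rewrite -[B _ _]/(BL _ _) /exp_sum linear_sum; apply: eq_bigr => k _.
  rewrite linearZ /= -[B _ _]/(BR _ _) linear_sum mulr_sumr.
  by apply: eq_bigr => j _; rewrite linearZ /= /F; ring.
rewrite (_ : series _ = fun n => B (exp_sum D n x) (exp_sum D n y) -
    (\sum_(k < n) \sum_(j < n) F k j
     - \sum_(m < n) \sum_(k < m.+1) F k (m - k)%N)).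
  rewrite -[B (exp_endo D x) _]subr0; apply: cvgB (cvg_square_sub_triangle FC).
  exact: cvg_biscalar_exp_sum.
apply/funext => n; rewrite BE opprB addrC subrK /series /= big_mkord.
apply: eq_bigr => m _; rewrite mulr_suml; apply: eq_bigr => k _.
(* The coefficient ['C(m, k) / m!] equals [1 / (k! (m - k)!)]. *)
rewrite -(bin_fact (ltnSE (ltn_ord k))) !natrM -mulr_natr /F.
have : 'C(m, k)%:R != 0 :> R by rewrite pnatr_eq0 -lt0n bin_gt0 ltnSE.
by move: (fact_neq0 k) (fact_neq0 (m - k)%N) => *; field; apply/and3P.
Qed.

End Exponential.

(** * Skew derivations and operator commutation *)

Section NormalCone.
Variables (R : realType) (V : vectType R) (J : euclidean_jordan_algebra V).
Local Notation "x ** y" := (jmul J x y) (at level 40, left associativity).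
Local Notation "'<<' x , y '>>'" := (jinner J x y).

(** Positive definiteness, applied to [x - y]. Testing against a vector turns identities in [V] into
    real ones, within reach of [lra]. *)
Lemma jinner_inj (x y : V) : (forall z, << x, z >> = << y, z >>) -> x = y.
Proof.
move=> xy; apply/eqP; rewrite -subr_eq0; apply/negP.
move=> /negP/(@neq0_dnorm_gt0 _ _ _ (jinner J)).
by rewrite linearBl /= xy subrr ltxx.
Qed.

(* Full polarization of the Jordan identity, of which the case [x = y = z] is
   three times [jmul_jordan]. Its right-hand side is symmetric in all four
   variables. *)
Lemma jordan_polarized (x y z w : V) :
  x ** ((y ** z) ** w) + y ** ((z ** x) ** w) + z ** ((x ** y) ** w)
  = (y ** z) ** (x ** w) + (z ** x) ** (y ** w) + (x ** y) ** (z ** w).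
Proof.
apply: jinner_inj => v.
have P u : << u ** ((u ** u) ** w), v >> = << (u ** u) ** (u ** w), v >>.
  by rewrite jmul_jordan.
(* Inclusion-exclusion over the sums of [x], [y], [z] isolates the part linear in each of them,
   which is twice the claim. *)
have := P (x + y + z); have := P (x + y); have := P (y + z); have := P (x + z).
have := P x; have := P y; have := P z.
rewrite !(linearDl, linearDr) /= !(jmulC J y x, jmulC J z x, jmulC J z y).
lra.
Qed.

Definition jcomm (x z w : V) : V := x ** (z ** w) - z ** (x ** w).

Lemma jcomm_derivation (x z y w : V) :
  jcomm x z (y ** w) = jcomm x z y ** w + y ** jcomm x z w.
Proof.
apply: jinner_inj => v.
(* These two instances have the same right-hand side; their difference is the
   claim. *)
have := congr1 (fun u => << u, v >>) (jordan_polarized x y w z).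
have := congr1 (fun u => << u, v >>) (jordan_polarized y z w x).
rewrite /jcomm !(linearDl, linearBl, linearBr) /=.
rewrite !(jmulC J z y, jmulC J y x, jmulC J z x) !(jmulC J _ w).
rewrite !(jmulC J (w ** _) x, jmulC J (w ** _) y, jmulC J (w ** _) z).
rewrite (jmulC J (x ** y) z) (jmulC J (y ** z) x) !(linearNr, linearNl) /=.
rewrite (jmulC J (y ** z) (w ** x)) (jmulC J (x ** y) (w ** z)).
lra.
Qed.

(** Multiplications are self-adjoint, so their commutator is skew. *)
Lemma jcomm_skew (x z u w : V) : << jcomm x z u, w >> = - << u, jcomm x z w >>.
Proof. by rewrite /jcomm linearBl linearBr /= !jinner_assoc opprB. Qed.

Lemma jcomm_linear (x z : V) : linear (jcomm x z).
Proof.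
move=> k u w; rewrite /jcomm !(linearPr, linearDr, linearZr_LR) /=.
by rewrite scalerBr opprD addrACA.
Qed.

Lemma jcomm_orthogonal_commute (a d : V) :
  (forall x z, << d, jcomm x z a >> = 0) -> operator_commute J a d.
Proof.
move=> D0 w; rewrite /jL /=; apply: jinner_inj => v.
(* Self-adjointness moves all multiplications off the test vector [v], leaving [a ** (d ** w)] on
   one side and [d ** (a ** w)] on the other. *)
have := D0 w v; rewrite /jcomm linearBr /= => /eqP; rewrite subr_eq0 => /eqP.
rewrite (jinner_assoc J a) (jmulC J d w) (jinner_assoc J w).
rewrite (jmulC J d (a ** w)) (jinner_assoc J (a ** w)).
by rewrite (jmulC J v a) (jmulC J w a) (jmulC J (a ** w) v).
Qed.

(** * Automorphisms generated by skew derivations *)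

(** By the Leibniz rule, the exponential series at [x ** y] is termwise the Cauchy product of the
    series at [x] and [y]. *)
Lemma exp_endo_morph (D : 'End(V)) (x y : V) :
  (forall u w, D (u ** w) = D u ** w + u ** D w) ->
  exp_endo D (x ** y) = exp_endo D x ** exp_endo D y.
Proof.
move=> derD; apply: scalar_ext => f lf.
have lB u : scalar (fun w => f (u ** w)) by move=> a v w; rewrite linearPr lf.
have lB' w : scalar (fun u => f (u ** w)) by move=> a u v; rewrite linearPl lf.
have H := @cvg_biscalar_cauchy _ _ D (fun u w => f (u ** w)) x y lB lB'.
rewrite -(cvg_lim (@Rhausdorff R) (@cvg_scalar_exp_sum _ _ D f (x ** y) lf)).
apply: cvg_lim => //; rewrite scalar_exp_sum //.
rewrite [X in series X @ _](_ : _ = fun m =>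
  (\sum_(k < m.+1) f (iter k D x ** iter (m - k) D y) *+ 'C(m, k)) / m`!%:R) //.
apply/funext => m; congr (_ / _).
pose F : {scalar V} := HB.pack f (GRing.isLinear.Build _ _ _ _ f lf).
rewrite (@iter_leibniz _ D (fun i j => iter i D x ** iter j D y)); last first.
  by move=> i j; exact: derD.
by rewrite -[f]/(F : V -> R) linear_sum; apply: eq_bigr => k _; rewrite linearMn.
Qed.

(** In the Cauchy product only the term of degree 0, [<< x, y >>], survives. *)
Lemma exp_endo_isometry (D : 'End(V)) (x y : V) :
  (forall u w, << D u, w >> = - << u, D w >>) ->
  << exp_endo D x, exp_endo D y >> = << x, y >>.
Proof.
move=> skD.
have lB u : scalar (jinner J u) by move=> a v w; rewrite linearPr.
have lB' w : scalar (fun u => << u, w >>) by move=> a u v; rewrite linearPl.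
have H := @cvg_biscalar_cauchy _ _ D (jinner J) x y lB lB'.
rewrite -(cvg_lim (@Rhausdorff R) H); apply: lim_near_cst => //.
near=> n; have n0 : (0 < n)%N by near: n; exact: nbhs_infty_gt.
rewrite /series /= -(prednK n0) big_nat_recl // big_ord1 fact0 bin0 mulr1n divr1.
rewrite big1 ?addr0 // => m _.
(* Skewness is the Leibniz rule for the zero derivation of the target [R]. *)
rewrite -(@iter_leibniz _ (\0 : {additive R -> R})
  (fun i j => << iter i D x, iter j D y >>)) ?mul0r //.
by move=> i j; rewrite /= skD addNr.
Unshelve. all: by end_near. Qed.

Lemma exp_jautomorphism (D : 'End(V)) :
  (forall u w, D (u ** w) = D u ** w + u ** D w) ->
  (forall u w, << D u, w >> = - << u, D w >>) ->
  jautomorphism J (linfun (exp_endo D)).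
Proof.
move=> derD skD; split; last by move=> x y; rewrite !lfunE /= exp_endo_morph.
(* An isometry is injective, hence bijective in finite dimension. *)
have : lker (linfun (exp_endo D)) == 0%VS.
  apply/lker0P => x y; rewrite !lfunE /= => exy; apply: jinner_inj => z.
  by rewrite -(exp_endo_isometry x z skD) exy exp_endo_isometry.
move=> kE; exists (linfun (exp_endo D))^-1%VF; first exact: lker0_lfunK.
exact: lker0_lfunVK.
Qed.

(** * First-order condition along the orbit *)

Lemma normal_cone_orbit_derivation (a d : V) (D : 'End(V)) :
  (forall u w, D (u ** w) = D u ** w + u ** D w) ->
  (forall u w, << D u, w >> = - << u, D w >>) ->
  normal_cone J (jorbit J a) a d -> << d, D a >> = 0.
Proof.
move=> derD skD nd.
have lf : scalar (jinner J d) by move=> k v w; rewrite linearPr.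
have [C [M [M0 DC]]] := scalar_iter_bounded D a lf.
have C0 : 0 <= C.
  by have := le_trans (normr_ge0 _) (DC 0%N); rewrite expr0 mulr1.
(* Expand [<< d, exp_endo (t *: D) a >>] to first order; normality bounds its excess over
   [<< d, a >>] by 0. *)
have key t : `|t| * M <= 2^-1 ->
    t * << d, D a >> <= t ^+ 2 * (C * (2 * M ^+ 2)).
  move=> tM; have iterZ k x : iter k (t *: D) x = t ^+ k *: iter k D x.
    elim: k => [|k IH]; first by rewrite scale1r.
    by rewrite !iterS IH scale_lfunE linearZ scalerA exprS.
  have Aut : jautomorphism J (linfun (exp_endo (t *: D))).
    apply: exp_jautomorphism => u w; rewrite !scale_lfunE.
      by rewrite derD scalerDr linearZl_LR linearZr_LR.
    by rewrite linearZl_LR linearZr_LR /= skD mulrN.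
  have := nd _ (ex_intro2 _ _ _ Aut erefl).
  rewrite lfunE /= linearBr /= => le0.
  have cv := @cvg_scalar_exp_sum _ _ (t *: D) _ a lf.
  rewrite scalar_exp_sum // in cv.
  have bd k : `|<< d, iter k (t *: D) a >> / k`!%:R| <=
      C * exp_coeff (`|t| * M) k.
    rewrite iterZ linearZr_LR /= normrM normfV normr_nat /exp_coeff /= mulrA.
    rewrite ler_wpM2r ?invr_ge0 // normrM normrX exprMn mulrCA.
    by rewrite ler_wpM2l ?exprn_ge0.
  have := dominated_series_taylor1 (mulr_ge0 (normr_ge0 t) M0) tM bd cv.
  rewrite /= !divr1 scale_lfunE linearZr_LR /= exprMn real_normK ?num_real //.
  rewrite ler_norml => /andP[+ _]; nra.
set K := C * (2 * M ^+ 2) in key; set c := << d, D a >> in key *.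
have K0 : 0 <= K by rewrite mulr_ge0 // mulr_ge0 // exprn_ge0.
(* Take [t = s] and [t = - s] in [key] and divide by [s]. *)
have step s : 0 < s -> s * M <= 2^-1 -> `|c| <= s * K.
  move=> s0 sM; rewrite ler_norml; apply/andP; split.
    have := key (- s); rewrite normrN gtr0_norm // => /(_ sM).
    by rewrite sqrrN expr2; nra.
  by have := key s; rewrite gtr0_norm // => /(_ sM); rewrite expr2; nra.
apply/eqP; rewrite -normr_le0; apply/ler_addgt0Pl => eps eps0; rewrite addr0.
(* The first bound yields [s * M <= 2^-1], the second [s * K <= eps]; adding 1 keeps the
   denominators positive when [M] or [K] vanishes. *)
pose s := Num.min (2 * (M + 1))^-1 (eps / (K + 1)).
have s0 : 0 < s by rewrite lt_min invr_gt0 divr_gt0 ?mulr_gt0 ?ltr_wpDl.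
have sM : s * M <= 2^-1.
  have : s <= (2 * (M + 1))^-1 by rewrite ge_min lexx.
  rewrite invfM => h.
  have : s * (M + 1) <= 2^-1 by rewrite -ler_pdivlMr ?ltr_wpDl.
  nra.
have sK : s * K <= eps.
  have : s <= eps / (K + 1) by rewrite ge_min lexx orbT.
  rewrite ler_pdivlMr ?ltr_wpDl //; nra.
exact: le_trans (step s s0 sM) sK.
Qed.

Lemma normal_cone_orbit_commute (a d : V) :
  normal_cone J (jorbit J a) a d -> operator_commute J a d.
Proof.
move=> nd; apply: jcomm_orthogonal_commute => x z.
pose L : {linear V -> V} :=
  HB.pack (jcomm x z) (GRing.isLinear.Build _ _ _ _ _ (jcomm_linear x z)).
have LE u : linfun L u = jcomm x z u by rewrite lfunE.
rewrite -LE; apply: normal_cone_orbit_derivation nd => u w; rewrite !LE.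
  exact: jcomm_derivation.
exact: jcomm_skew.
Qed.

End NormalCone.

Theorem theorem1p1 (R : realType) (V : vectType R)
    (J : euclidean_jordan_algebra V) (Jtr : trace_inner_product J)
    (E : set V) (hE : weakly_spectral J E) (a : V) (ha : E a) :
  (forall d : V, normal_cone J E a d -> operator_commute J a d) /\
  (forall d : V, normal_cone J (jorbit J a) a d -> operator_commute J a d).
Proof.
split=> d nd; apply: normal_cone_orbit_commute => // x [A autA ->].
by apply: nd; apply: (hE A autA); exists a.
Qed.
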